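(* Let $q \equiv 5 \pmod 8$ be a prime power such that $q = s^2+4$ for some odd integer $s$. Then the eigenvalues of the adjacency matrix of the cyclotomic tournament $CT_q$ are $$\frac{q-1}{2},\qquad \frac{-1 \pm i\sqrt{q - 2\sqrt{q}}}{2},\qquad \frac{-1 \pm i\sqrt{q+2\sqrt{q}}}{2},$$ where $\frac{q-1}{2}$ has multiplicity $1$ and each of the other four eigenvalues has multiplicity $\frac{q-1}{4}$.
   Context: Cyclotomic tournament: let $q$ be a prime power with $q \equiv 5 \pmod 8$, let $g$ be a generator of $\mathbb{F}_q^*$, let $C_0^{(4)}$ be the subgroup of index $4$ in $\mathbb{F}_q^*$ and $C_i^{(4)} = g^i C_0^{(4)}$. Put $D = C_0^{(4)} \cup C_1^{(4)}$. The cyclotomic tournament $CT_q$ has vertex set $\mathbb{F}_q$ and an arc from $x$ to $y$ if and only if $x - y \in D$. Its adjacency matrix $A$ is the $q\times q$ $0/1$ matrix indexed by $\mathbb{F}_q$ with $A_{xy}=1$ iff there is an arc from $x$ to $y$. *)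

(* Defs.v *)
From HB Require Import structures.
From mathcomp Require Import all_boot all_order all_algebra all_field.
Set Implicit Arguments. Unset Strict Implicit. Unset Printing Implicit Defensive.
Import GRing.Theory Num.Theory.
Local Open Scope ring_scope.

(* C_0^{(4)}: the subgroup of index 4 of F^*, i.e. the nonzero fourth powers. *)
Definition cyc4 (F : finFieldType) : {set F} :=
  [set x : F | [exists y : F, (y != 0) && (x == y ^+ 4)]].

Definition ct_conn (F : finFieldType) (g : F) : {set F} :=
  cyc4 F :|: [set g * x | x in cyc4 F].

Definition ct_adj (F : finFieldType) (g : F) : 'M[algC]_#|F| :=
  \matrix_(i < #|F|, j < #|F|)
     ((enum_val i - enum_val j \in ct_conn g) : nat)%:R.

(* Main.v *)
(** Write [A] for the adjacency matrix, [I] and [J] for the identity and all-one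
    matrices, and [M = 2A - J + I].  With [chi] a quartic character of [F],
    [M] is the convolution matrix of [ct_sign = (1-i)/2 chi + (1+i)/2 chi^-1],
    so if the Jacobi sum [J(chi, chi)] is [a + b i] and [B] is the convolution
    matrix of [chi^2], then [M^2 = b B - (q I - J)] and [B^2 = q I - J].
    Here [a^2 + b^2 = q] and [b] is even.  The characteristic [p] does not divide
    [a]: otherwise it would divide [b] too, whereas [J(chi^-1, chi^-1)] reduces in
    [F] to the binomial coefficient [C(3f, f)] up to sign, with [f = (q-1)/4], which
    is prime to [p].  Such a representation of [q = s^2 + 4] as a sum of two
    squares is unique, so [b = +-2].

    Eigenvectors are never needed.  With [Y = 2X + 1] put [D = det(Y I - M - J)].
    Transposition turns [M] into [-M], so
    [D^2 = det((Y^2 + q) I + (q - 1 - 2Y) J - b B)]; permuting the indices by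
    [x |-> g x] turns [B] into [-B], so [D^4] is the determinant of an explicit
    combination of [I] and [J], equal to
    [(Y - q)^4 ((Y^2 + q)^2 - 4q)^(q-1)].  Both [D] and the expected product have
    the same leading coefficient, and so agree because their fourth powers do. *)
Require Import Defs.
From HB Require Import structures.
From mathcomp Require Import all_boot all_order all_algebra all_field.
From mathcomp Require Import perm ring zify.
Import GRing.Theory Num.Theory.
Set Implicit Arguments. Unset Strict Implicit. Unset Printing Implicit Defensive.
Local Open Scope ring_scope.

(** * Convolution matrices on a finite field *)

Section Cayley.
Variables (F : finFieldType) (R : comNzRingType).
Implicit Types h k : F -> R.

Definition conv h k (x : F) : R := \sum_y h y * k (x - y).

Definition cay h : 'M[R]_#|F| :=
  \matrix_(i < #|F|, j < #|F|) h (enum_val i - enum_val j).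

Lemma cayM h k : cay h *m cay k = cay (conv h k).
Proof.
apply/matrixP => i j; rewrite !mxE.
rewrite (reindex (@enum_rank F)) /=; last first.
  by apply: onW_bij; exists enum_val; [exact: enum_rankK | exact: enum_valK].
rewrite /conv (reindex_inj (inv_inj (subKr (enum_val i)))) /=.
by apply: eq_bigr => y _; rewrite !mxE enum_rankK opprB addrAC addrCA subrr addr0.
Qed.

Lemma eq_cay h k : h =1 k -> cay h = cay k.
Proof. by move=> e; apply/matrixP => i j; rewrite !mxE e. Qed.

(** The map [x |-> c x] permutes rows and columns alike, so its sign enters twice. *)
Lemma det_cay_scale h (c : F) :
  c != 0 -> \det (cay (fun x => h (c * x))) = \det (cay h).
Proof.
move=> c0.
have inj : injective (fun i : 'I_#|F| => enum_rank (c * enum_val i)).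
  by move=> i j /enum_rank_inj /(mulfI c0) /enum_val_inj.
pose s := perm inj.
have -> : cay (fun x => h (c * x)) = row_perm s (col_perm s (cay h)).
  by apply/matrixP => i j; rewrite !mxE !permE !enum_rankK mulrBr.
rewrite row_permE col_permE !det_mulmx !det_perm odd_permV.
by rewrite mulrCA -signr_addb addbb mulr1.
Qed.

(* Stated with a factor [u] on the left since [u] need not be a unit. *)
Lemma det_scalar_const n (u v : R) :
  u * \det (u%:M + const_mx v : 'M[R]_n) = (u + n%:R * v) * u ^+ n.
Proof.
(* Border the matrix by [r] and [c]: a row operation leaves [u I + const v] as Schur complement, a
   column operation makes [A] block triangular with corner [u + n v]. *)
pose r : 'rV[R]_n := const_mx (-1); pose c : 'cV[R]_n := const_mx v.
pose A := block_mx (1%:M : 'M_1) r c u%:M.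
have detA : \det A = \det (u%:M + const_mx v : 'M[R]_n).
  transitivity (\det (block_mx 1%:M 0 (- c) 1%:M *m A)).
    by rewrite det_mulmx det_lblock !det1 !mul1r.
  rewrite mulmx_block !mul1mx !mul0mx !addr0.
  rewrite mulmx1 addNr det_ublock det1 mul1r; congr (\det _).
  apply/matrixP => i j; rewrite !mxE big_ord1 !mxE.
  by rewrite mulrN1 opprK addrC.
transitivity (\det (A *m block_mx u%:M 0 (- c) 1%:M)).
  by rewrite det_mulmx det_lblock det1 mulr1 det_scalar expr1 detA mulrC.
rewrite mulmx_block !mul1mx !mulmx0 !mulmx1.
rewrite !add0r mulmxN mul_mx_scalar mul_scalar_mx scalerN subrr.
rewrite det_ublock !det_scalar; congr (_ * _).
rewrite [_ - _]mx11_scalar det_scalar1 !mxE.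
under eq_bigr do rewrite !mxE mulN1r.
by rewrite sumrN sumr_const card_ord opprK mulr_natl mulr1n.
Qed.
End Cayley.

Section ConvAlgebra.
Variables (F : finFieldType) (R : comNzRingType).
Local Notation q := #|F|.
Implicit Types h k : F -> R.

Lemma eq_conv h1 h2 k1 k2 x : h1 =1 h2 -> k1 =1 k2 -> conv h1 k1 x = conv h2 k2 x.
Proof. by move=> eh ek; apply: eq_bigr => y _; rewrite eh ek. Qed.

Lemma conv_comb (u v u' v' : R) h k h' k' x :
  conv (fun y => u * h y + v * k y) (fun y => u' * h' y + v' * k' y) x =
  u * u' * conv h h' x + u * v' * conv h k' x
  + v * u' * conv k h' x + v * v' * conv k k' x.
Proof.
rewrite /conv !mulr_sumr -!big_split /=; apply: eq_bigr => y _; ring.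
Qed.

Lemma conv_delta h (u v : R) x :
  conv h (fun x => u * (x == 0)%:R + v) x = u * h x + v * \sum_y h y.
Proof.
rewrite /conv; under eq_bigr do rewrite mulrDr.
rewrite big_split /= -mulr_suml [v * _]mulrC; congr (_ + _).
rewrite (bigD1 x) //= subrr eqxx mulr1 mulrC big1 ?addr0 // => y yx.
by rewrite subr_eq0 eq_sym (negPf yx) !mulr0.
Qed.

(** The delta function is a unit for convolution, and a constant convolved with a zero-sum function
    gives 0. *)
Lemma conv_affine (u v u' v' : R) k k' x : \sum_y k y = 0 -> \sum_y k' y = 0 ->
  conv (fun y => u * (y == 0)%:R + v + k y) (fun y => u' * (y == 0)%:R + v' + k' y) x =
  u * u' * (x == 0)%:R + (u * v' + u' * v + q%:R * v * v')
  + (u * k' x + u' * k x) + conv k k' x.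
Proof.
move=> k0 k0'.
pose d (y : F) : R := (y == 0)%:R.
have sd h : \sum_y d y * h y = h 0.
  rewrite (bigD1 0) //= /d eqxx mul1r big1 ?addr0 // => y y0.
  by rewrite (negPf y0) mul0r.
have cd h : conv d h x = h x by rewrite /conv sd subr0.
have sub (h : F -> R) : \sum_y h (x - y) = \sum_y h y.
  by rewrite [RHS](reindex_inj (inv_inj (subKr x))).
have cd' h : conv h d x = h x.
  rewrite -[RHS]cd /conv [RHS](reindex_inj (inv_inj (subKr x))).
  by apply: eq_bigr => y _; rewrite subKr mulrC.
have c1 h : conv (fun=> 1) h x = \sum_y h y.
  by rewrite -sub; apply: eq_bigr => y _; rewrite mul1r.
have c1' h : conv h (fun=> 1) x = \sum_y h y.
  by apply: eq_bigr => y _; rewrite mulr1.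
pose e1 y := u * d y + v * 1; pose e2 y := u' * d y + v' * 1.
rewrite (eq_conv (h2 := fun y => 1 * e1 y + 1 * k y)
  (k2 := fun y => 1 * e2 y + 1 * k' y)); last 2 first.
- by move=> y; rewrite /e1 /e2 /d !mul1r mulr1.
- by move=> y; rewrite /e1 /e2 /d !mul1r mulr1.
rewrite conv_comb !mul1r.
have -> : conv e1 e2 x = u * u' * (x == 0)%:R + (u * v' + u' * v + q%:R * v * v').
  rewrite conv_comb !cd c1 c1' sumr_const cardT -cardE.
  have -> : \sum_y d y = 1.
    by rewrite -[RHS](sd (fun=> 1)); apply: eq_bigr => y _; rewrite mulr1.
  rewrite /d; ring.
have -> : conv e1 k' x = u * k' x.
  (* A dummy zero summand gives [k'] the shape that [conv_comb] expects. *)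
  rewrite (eq_conv (h2 := e1) (k2 := fun y => 1 * k' y + 0 * k' y)) //; last first.
    by move=> y; rewrite mul1r mul0r addr0.
  rewrite conv_comb cd c1 k0'; ring.
have -> : conv k e2 x = u' * k x.
  rewrite (eq_conv (h2 := fun y => 1 * k y + 0 * k y) (k2 := e2)) //; last first.
    by move=> y; rewrite mul1r mul0r addr0.
  rewrite conv_comb cd' c1' k0; ring.
by ring.
Qed.

End ConvAlgebra.

Lemma conv_rmorph (F : finFieldType) (R S : comNzRingType) (phi : {rmorphism R -> S})
    (h k : F -> R) x :
  conv (phi \o h) (phi \o k) x = phi (conv h k x).
Proof. by rewrite /conv rmorph_sum; apply: eq_bigr => y _; rewrite rmorphM. Qed.

(** * The determinant from convolution identities *)

Section Determinant.
Variables (F : finFieldType) (R : idomainType) (f psi : F -> R) (b Y : R) (c : F).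
Local Notation q := #|F|.
Hypothesis f0 : \sum_x f x = 0.
Hypothesis fN : forall x, f (- x) = - f x.
Hypothesis ff : forall x, conv f f x = b * psi x - (q%:R * (x == 0)%:R - 1).
Hypothesis psi0 : \sum_x psi x = 0.
Hypothesis pp : forall x, conv psi psi x = q%:R * (x == 0)%:R - 1.
Hypothesis c0 : c != 0.
Hypothesis psic : forall x, psi (c * x) = - psi x.
Hypothesis b2 : b ^+ 2 = 4.

(** Meant for [f = ct_sign], [psi = chi^2], [c = g] and [Y = 2X + 1] over polynomials. The condition
    [u != 0] serves to cancel the extra factor in [det_scalar_const]. *)
Lemma det_tournament :
  let u := (Y ^+ 2 + q%:R) ^+ 2 - 4 * q%:R in
  u != 0 ->
  (\det (cay (fun x => Y * (x == 0)%:R - 1 - f x))) ^+ 4 = (Y - q%:R) ^+ 4 * u ^+ q.-1.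
Proof.
move=> u u0; set D := \det _.
pose U := Y ^+ 2 + q%:R; pose w := q%:R - 1 - 2 * Y.
pose D2 := \det (cay (fun x => U * (x == 0)%:R + w - b * psi x)).
have D2E : D ^+ 2 = D2.
  have DN : D = \det (cay (fun x => Y * (x == 0)%:R - 1 + f x)).
    rewrite -(@det_cay_scale _ _ _ (-1)) ?oppr_eq0 ?oner_eq0 //; congr (\det _).
    by apply: eq_cay => x; rewrite mulN1r oppr_eq0 fN.
  rewrite expr2 {2}DN -det_mulmx cayM; congr (\det _); apply: eq_cay => x.
  rewrite (@conv_affine _ _ _ _ _ _ (fun y => - f y)) ?sumrN ?f0 ?oppr0 //.
  have -> : conv (fun y => - f y) f x = - conv f f x.
    by rewrite /conv -sumrN; apply: eq_bigr => y _; rewrite mulNr.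
  rewrite ff /U /w; ring.
have D2N : D2 = \det (cay (fun x => U * (x == 0)%:R + w + b * psi x)).
  rewrite /D2 -(det_cay_scale _ c0); congr (\det _).
  by apply: eq_cay => x; rewrite mulf_eq0 (negPf c0) psic mulrN opprK.
pose v := 2 * U * w + q%:R * w ^+ 2 + 4.
have D4E : D ^+ 4 = \det (u%:M + const_mx v : 'M_q).
  rewrite (exprM D 2 2) D2E expr2 {2}D2N -det_mulmx cayM; congr (\det _).
  apply/matrixP => i k; rewrite !mxE.
  have bpsi0 : \sum_y b * psi y = 0 by rewrite -mulr_sumr psi0 mulr0.
  rewrite (@conv_affine _ _ _ _ _ _ (fun y => - (b * psi y))) ?sumrN ?bpsi0 ?oppr0 //.
  have -> : conv (fun y => - (b * psi y)) (fun y => b * psi y) (enum_val i - enum_val k)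
      = - b ^+ 2 * conv psi psi (enum_val i - enum_val k).
    by rewrite /conv mulr_sumr; apply: eq_bigr => y _; ring.
  rewrite pp b2 subr_eq0 (inj_eq enum_val_inj) -[u *+ _]mulr_natr /v /u -/U; ring.
have q0 : (0 < q)%N by apply/card_gt0P; exists 0.
apply: (mulfI u0); rewrite D4E det_scalar_const -{2}(prednK q0) exprS.
(* Here [u + q v = (U + q w)^2] and [U + q w = (Y - q)^2]. *)
rewrite [RHS]mulrCA; congr (_ * _); rewrite /v /u -/U /w /U; ring.
Qed.
End Determinant.

(** * Multiplicative characters of order 4 *)

Section MultiplicativeCharacters.
Variables (F : finFieldType) (K : fieldType).
Implicit Types psi : F -> K.

Definition mulchar psi :=
  [/\ psi 0 = 0, psi 1 = 1 & {morph psi : x y / x * y}].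

Lemma sum_mulchar psi c : mulchar psi -> psi c != 1 -> c != 0 -> \sum_x psi x = 0.
Proof.
move=> [_ _ psiM] psic c0; apply/eqP.
have e : \sum_x psi x = psi c * \sum_x psi x.
  rewrite {1}(reindex_inj (mulfI c0)) mulr_sumr.
  by apply: eq_bigr => x _; rewrite psiM.
have : (1 - psi c) * \sum_x psi x == 0 by rewrite mulrBl mul1r -e subrr.
by rewrite mulf_eq0 subr_eq0 eq_sym (negPf psic).
Qed.

Lemma conv_mulchar psi1 psi2 x : mulchar psi1 -> mulchar psi2 -> x != 0 ->
  conv psi1 psi2 x = psi1 x * psi2 x * conv psi1 psi2 1.
Proof.
move=> [_ _ M1] [_ _ M2] x0; rewrite /conv (reindex_inj (mulfI x0)) mulr_sumr.
apply: eq_bigr => y _.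
by rewrite -{2}[x]mulr1 -mulrBr M1 M2; ring.
Qed.

Lemma conv_mulchar0 psi1 psi2 : mulchar psi2 ->
  conv psi1 psi2 0 = psi2 (- 1) * \sum_x psi1 x * psi2 x.
Proof.
move=> [_ _ M2]; rewrite /conv mulr_sumr; apply: eq_bigr => y _.
by rewrite sub0r -[- y]mulN1r M2 mulrCA.
Qed.

(** At [x = 0] each nonzero [y] contributes [psi1 (-1)]. Other [x] scale to 1, where the summand is
    [psi1 (y / (1 - y))]; as [y / (1 - y)] takes every value except -1 once, the sum is
    [- psi1 (-1)]. *)
Lemma conv_mulchar_inv psi1 psi2 c x : mulchar psi1 -> mulchar psi2 ->
    (forall y, psi1 y * psi2 y = (y != 0)%:R) -> psi1 c != 1 -> c != 0 ->
  conv psi1 psi2 x = psi1 (- 1) * (#|F|%:R * (x == 0)%:R - 1).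
Proof.
move=> m1 m2 inv12 nc c0; have [z1 o1 M1] := m1; have [z2 o2 M2] := m2.
have N11 : psi1 (-1) * psi1 (-1) = 1 by rewrite -M1 mulrNN mulr1.
have N12 : psi1 (-1) * psi2 (-1) = 1 by rewrite inv12 oppr_eq0 oner_eq0.
have N2 : psi2 (-1) = psi1 (-1) by rewrite -[LHS]mul1r -N11 -mulrA N12 mulr1.
case: eqVneq => [->|x0].
  rewrite conv_mulchar0 // N2 mulr1; congr (_ * _).
  under eq_bigr do rewrite inv12.
  rewrite (bigD1 0) //= eqxx add0r (eq_bigr (fun=> 1)) => [|y -> //].
  by rewrite sumr_const cardC1 -subn1 natrB //; apply/card_gt0P; exists 0.
rewrite conv_mulchar // inv12 x0 mul1r mulr0 sub0r mulrN1.
have := sum_mulchar m1 nc c0.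
rewrite (bigD1 (-1)) //= => /eqP; rewrite addrC addr_eq0 => /eqP <-.
rewrite /conv (bigD1 1) //= subrr z2 mulr0 add0r.
have im (y : F) : y != 1 -> y / (1 - y) != -1.
  move=> y1; have y1' : 1 - y != 0 by rewrite subr_eq0 eq_sym.
  apply/negP => /eqP /(congr1 ( *%R^~ (1 - y))); rewrite divfK // mulN1r opprB.
  by move/eqP; rewrite -subr_eq0 opprB addrCA subrr addr0 oner_eq0.
rewrite [RHS](reindex_onto (fun y : F => y / (1 - y)) (fun z => z / (1 + z))) /=.
  apply: eq_big => [y|y y1].
    case: (eqVneq y 1) => [->|y1] /=.
      by rewrite subrr invr0 mulr0 mul0r [0 == 1]eq_sym oner_eq0 andbF.
    rewrite im //=; apply/esym/eqP; have y1' : 1 - y != 0 by rewrite subr_eq0 eq_sym.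
    have e : 1 + y / (1 - y) = (1 - y)^-1 by field.
    by rewrite e invrK divfK.
  have y1' : 1 - y != 0 by rewrite subr_eq0 eq_sym.
  have i2 : psi2 (1 - y) = psi1 (1 - y)^-1.
    have := inv12 (1 - y); rewrite y1' => iy.
    have e : psi1 (1 - y)^-1 * psi1 (1 - y) = 1 by rewrite -M1 mulVf.
    by rewrite -[LHS]mul1r -e -mulrA iy mulr1.
  by rewrite M1 i2.
move=> z zN1; have z1' : 1 + z != 0 by rewrite addrC addr_eq0.
have e : 1 - z / (1 + z) = (1 + z)^-1 by field.
by rewrite e invrK divfK.
Qed.
End MultiplicativeCharacters.

Section QuarticCharacters.
Variables (F : finFieldType) (g : F).
Hypothesis cardF : (#|F| %% 8 = 5)%N.
Hypothesis gen : forall x : F, x != 0 -> exists k : nat, x = g ^+ k.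
Local Notation q := #|F|.

Lemma gen_neq0 : g != 0.
Proof.
apply/eqP => g0; have : (q <= 2)%N.
  apply: (leq_trans _ (card_size [:: 0; 1 : F])); apply: subset_leq_card.
  apply/subsetP => x _; rewrite !inE; case: eqVneq => //= x0.
  have [[|k] e] := gen x0; first by rewrite e expr0 eqxx.
  by rewrite e g0 exprS mul0r eqxx in x0.
by lia.
Qed.

(** The powers of [g] exhaust the [q - 1] nonzero elements, so its order cannot be smaller. *)
Lemma gen_prim : q.-1.-primitive_root g.
Proof.
have q0 : (0 < q.-1)%N by lia.
have gq : g ^+ q.-1 = 1.
  apply: (mulfI gen_neq0); rewrite -exprS mulr1 prednK ?expf_card //; lia.
have [m mP dm] := prim_order_exists q0 gq.
suff -> : q.-1 = m by [].
apply/eqP; rewrite eqn_leq (dvdn_leq _ dm) // andbT.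
rewrite -(cardC1 (0 : F)) -[leqRHS]card_ord.
apply: leq_trans (leq_image_card (fun i : 'I_m => g ^+ i) _).
apply: subset_leq_card; apply/subsetP => x; rewrite !inE => /gen [k ->].
have m0 := prim_order_gt0 mP.
rewrite -(prim_expr_mod mP); apply/imageP.
by exists (Ordinal (ltn_pmod k m0)).
Qed.

(* Discrete logarithm in base [g], with the junk value [q.-1] at [0]. *)
Definition lg (x : F) := index x (mkseq (fun k => g ^+ k) q.-1).

Lemma lgK x : x != 0 -> g ^+ lg x = x.
Proof.
move=> x0; have xin : x \in mkseq (fun k => g ^+ k) q.-1.
  have [k ->] := gen x0; rewrite -(prim_expr_mod gen_prim); apply: map_f.
  by rewrite mem_iota ltn_pmod ?(prim_order_gt0 gen_prim).
have := nth_index 0 xin; rewrite nth_mkseq //.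
by move: xin; rewrite -index_mem size_mkseq.
Qed.

Lemma eq_gen_exp4 m n : g ^+ m = g ^+ n -> (m %% 4 = n %% 4)%N.
Proof.
move/eqP; rewrite (eq_prim_root_expr gen_prim) => /eqP e.
have d4 : (4 %| q.-1)%N by lia.
by rewrite -(modn_dvdm m d4) e modn_dvdm.
Qed.

Lemma genN1 : g ^+ q.-1./2 = -1.
Proof.
have e : (q.-1./2 * 2 = q.-1)%N by lia.
have : (g ^+ q.-1./2) ^+ 2 == 1.
  by rewrite -exprM e; apply/eqP/(prim_expr_order gen_prim).
rewrite sqrf_eq1 => /orP [|/eqP //].
rewrite -[1](expr0 g) (eq_prim_root_expr gen_prim) mod0n modn_small; lia.
Qed.

Section Chi.
Variables (K : fieldType).

(** The image [j] of [g] and the field [K] are parameters: fourth roots of unity [j] give all powers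
    of the quartic character, with values in [algC] or in [F] itself. *)
Definition chi (j : K) (x : F) : K := if x == 0 then 0 else j ^+ lg x.

Lemma expr_mod4 (j : K) m n : j ^+ 4 = 1 -> (m %% 4 = n %% 4)%N -> j ^+ m = j ^+ n.
Proof. by move=> j4 e; rewrite -(expr_mod m j4) e expr_mod. Qed.

Lemma chi0 j : chi j 0 = 0. Proof. by rewrite /chi eqxx. Qed.

Lemma chi_gen j k : j ^+ 4 = 1 -> chi j (g ^+ k) = j ^+ k.
Proof.
move=> j4; have nz : g ^+ k != 0 by rewrite expf_neq0 ?gen_neq0.
by rewrite /chi (negPf nz); apply: expr_mod4 => //; apply: eq_gen_exp4; rewrite lgK.
Qed.

Lemma chi_mulchar j : j ^+ 4 = 1 -> mulchar (chi j).
Proof.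
move=> j4; split; first exact: chi0; first by rewrite -(expr0 g) chi_gen.
move=> x y; have [->|x0] := eqVneq x 0; first by rewrite !(mul0r, chi0).
have [->|y0] := eqVneq y 0; first by rewrite !(mulr0, chi0).
by rewrite -(lgK x0) -(lgK y0) -exprD !chi_gen // exprD.
Qed.

Lemma chiM j k x : chi j x * chi k x = chi (j * k) x.
Proof. by rewrite /chi; case: eqP; rewrite ?mul0r // exprMn. Qed.

Lemma chi1 x : chi 1 x = (x != 0)%:R.
Proof. by rewrite /chi expr1n; case: eqP. Qed.

(** Since [q] is 5 modulo 8, the exponent [(q - 1) / 2] of -1 is 2 modulo 4. *)
Lemma chiN1 j : j ^+ 4 = 1 -> chi j (- 1) = j ^+ 2.
Proof. by move=> j4; rewrite -genN1 chi_gen //; apply: expr_mod4 => //; lia. Qed.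

Lemma sum_chi j : j ^+ 4 = 1 -> j != 1 -> \sum_x chi j x = 0.
Proof.
move=> j4 j1; apply: (sum_mulchar (chi_mulchar j4) _ gen_neq0).
by rewrite -[g]expr1 chi_gen.
Qed.

Lemma conv_chi_inv j k x : j ^+ 4 = 1 -> j * k = 1 -> j != 1 ->
  conv (chi j) (chi k) x = j ^+ 2 * (q%:R * (x == 0)%:R - 1).
Proof.
move=> j4 jk j1.
have k4 : k ^+ 4 = 1 by rewrite -[LHS]mul1r -j4 -exprMn jk expr1n.
have inv y : chi j y * chi k y = (y != 0)%:R by rewrite chiM jk chi1.
rewrite (conv_mulchar_inv x (chi_mulchar j4) (chi_mulchar k4) inv (c := g))
  ?gen_neq0 ?chiN1 //.
by rewrite -[g]expr1 chi_gen.
Qed.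

(** Here [chi (-1)] is the square of [chi j], the quadratic character. At 0 both sides vanish
    because it sums to 0. *)
Lemma conv_chi_sqr j x : j ^+ 2 = -1 -> j ^+ 2 != 1 ->
  conv (chi j) (chi j) x = conv (chi j) (chi j) 1 * chi (-1) x.
Proof.
move=> j2 nN1; have j4 : j ^+ 4 = 1 by rewrite (exprM j 2 2) j2 sqrrN expr1n.
have m := chi_mulchar j4.
have [->|x0] := eqVneq x 0.
  rewrite conv_mulchar0 // chi0 mulr0.
  under eq_bigr do rewrite chiM -expr2 j2.
  by rewrite -j2 sum_chi ?mulr0 // -exprM mulnC exprM j4 expr1n.
by rewrite conv_mulchar // chiM -expr2 j2 mulrC.
Qed.

(** The coefficient of [j ^+ k] in the Jacobi sum. It does not depend on [K], so the same integers
    describe the sum in [algC] and in [F]. *)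
Definition jacobi_count k :=
  #|[pred y : F | [&& y != 0%R, y != 1%R & (lg y + lg (1 - y)%R) %% 4 == k]%N]|.

Lemma jacobi_expand j : j ^+ 4 = 1 ->
  conv (chi j) (chi j) 1 = \sum_(k < 4) j ^+ k *+ jacobi_count k.
Proof.
move=> j4; rewrite /conv (bigID [pred y : F | (y != 0) && (y != 1)]) /=.
rewrite [X in _ + X]big1 ?addr0; last first.
  move=> y; rewrite negb_and !negbK => /orP [/eqP -> | /eqP ->].
    by rewrite chi0 mul0r.
  by rewrite subrr chi0 mulr0.
rewrite (partition_big (fun y => inord ((lg y + lg (1 - y)) %% 4) : 'I_4) predT) //=.
apply: eq_bigr => k _; rewrite -sumr_const.
apply: eq_big => y.
  rewrite !inE -andbA; congr [&& _, _ & _].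
  by rewrite -val_eqE /= inordK // ltn_pmod.
case/andP => /andP [y0 y1] /eqP <-.
rewrite inordK ?ltn_pmod // expr_mod // exprD /chi (negPf y0).
by rewrite subr_eq0 eq_sym (negPf y1).
Qed.

End Chi.
End QuarticCharacters.

(** * The quartic Jacobi sum when q = s^2 + 4 *)

(** Legendre's formula padded with zero terms, so that several factorials share one range of
    summation. *)
Lemma logn_fact_widen p m N : prime p -> (m < N)%N ->
  logn p m`! = (\sum_(1 <= k < N) m %/ p ^ k)%N.
Proof.
move=> pp mN; rewrite logn_fact // [RHS](big_cat_nat (n := m.+1)) //=.
rewrite [X in (_ + X)%N]big_nat_cond [X in (_ + X)%N]big1 ?addn0 // => k.
rewrite andbT => /andP [mk _]; apply: divn_small.
by apply: leq_trans mk _; apply: ltnW; apply: ltn_expl; apply: prime_gt1.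
Qed.

(** Odd squares are 1 modulo 8, so [n] is odd and [p] itself is 5 modulo 8. *)
Lemma prime_pow_mod8 p n : (p ^ n %% 8 = 5)%N -> (p %% 4 = 1)%N.
Proof.
move=> e.
have op : odd p.
  case: n e => [//|n] e; have : odd (p ^ n.+1) by lia.
  by rewrite oddX.
have p2 : (p ^ 2 %% 8 = 1)%N.
  rewrite -modnXm; have : (p %% 8 \in [:: 1; 3; 5; 7])%N by rewrite !inE; lia.
  by rewrite !inE => /or4P [] /eqP ->.
move: e; rewrite -[n]odd_double_half -mul2n expnD expnM -modnMmr -modnXm p2 exp1n.
by case: (odd n); rewrite /= ?expn1 ?muln1; lia.
Qed.

(** By Legendre's formula it suffices that adding [f] and [2f] in base [p] produces no carry. *)
Lemma prime_ndvd_bin3 p n f : prime p -> (p ^ n %% 8 = 5)%N ->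
  (p ^ n)%N = (4 * f).+1 -> ~~ (p %| 'C(3 * f, f))%N.
Proof.
move=> pp e8 ef; have p4 := prime_pow_mod8 e8; have p1 := prime_gt1 pp.
have C0 : (0 < 'C(3 * f, f))%N by rewrite bin_gt0; lia.
suff : logn p 'C(3 * f, f) == 0%N.
  by rewrite -leqn0 leqNgt -pfactor_dvdn // expn1.
have fle : (f <= 3 * f)%N by lia.
have := congr1 (logn p) (bin_fact fle).
rewrite lognM ?muln_gt0 ?fact_gt0 // lognM ?fact_gt0 //.
rewrite (_ : 3 * f - f = 2 * f)%N; last by lia.
rewrite !(logn_fact_widen (N := p ^ n)) //; try by lia.
suff -> : (\sum_(1 <= k < p ^ n) (3 * f) %/ p ^ k =
  \sum_(1 <= k < p ^ n) f %/ p ^ k + \sum_(1 <= k < p ^ n) (2 * f) %/ p ^ k)%N.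
  by move=> h; apply/eqP; lia.
rewrite -big_split /=; apply: eq_bigr => k _.
have [kn|nk] := leqP k n; last first.
  have h : (p ^ n < p ^ k)%N by rewrite ltn_exp2l.
  by rewrite !divn_small //; lia.
have pm i : (p ^ i %% 4 = 1)%N by rewrite -modnXm p4 exp1n.
have : (p ^ k * p ^ (n - k) = (4 * f).+1)%N by rewrite -expnD subnKC.
move: (pm k) (pm (n - k)%N); move: (p ^ k)%N (p ^ (n - k))%N => P Q Pm Qm PQ.
have [a ea] : exists a, P = (4 * a).+1 by exists (P %/ 4)%N; lia.
have [b eb] : exists b, Q = (4 * b).+1 by exists (Q %/ 4)%N; lia.
(* Since [3a < P], the quotients of [f], [2f], [3f] by [P] are [b], [2b], [3b]. *)
have ef' : f = (b * P + a)%N by nia.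
have P0 : (0 < P)%N by lia.
rewrite ef' !mulnDr !mulnA !divnMDl // !divn_small; lia.
Qed.

(** * Power sums over the finite field *)

Section FieldSums.
Variables (F : finFieldType) (g : F).
Hypothesis cardF : (#|F| %% 8 = 5)%N.
Hypothesis gen : forall x : F, x != 0 -> exists k : nat, x = g ^+ k.
Local Notation q := #|F|.
Local Notation f := (#|F| %/ 4)%N.

Lemma sum_expr k : ~~ (q.-1 %| k)%N -> \sum_(y : F) y ^+ k = 0.
Proof.
move=> nk; have g0 := gen_neq0 cardF gen.
apply/eqP; have e : \sum_(y : F) y ^+ k = g ^+ k * \sum_(y : F) y ^+ k.
  rewrite {1}(reindex_inj (mulfI g0)) mulr_sumr.
  by apply: eq_bigr => y _; rewrite exprMn.
have : (1 - g ^+ k) * \sum_(y : F) y ^+ k == 0 by rewrite mulrBl mul1r -e subrr.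
rewrite mulf_eq0 subr_eq0 eq_sym (_ : (_ == 1) = false) //.
by apply/negbTE; rewrite -(prim_order_dvd (gen_prim cardF gen)).
Qed.

Lemma natr_card_eq0 : q%:R = 0 :> F.
Proof.
have [p pp pF] := finPcharP F; apply/eqP; rewrite -(dvdn_pcharf pF).
have e : q = (p ^ logn p q)%N := card_pprimeChar pF.
rewrite e; case: logn e => [|n _]; first by lia.
by rewrite expnS dvdn_mulr.
Qed.

Lemma sum_expr_pred : \sum_(y : F) y ^+ q.-1 = -1.
Proof.
have q0 : (0 < q)%N by lia.
have q1 : (q.-1 == 0)%N = false by lia.
rewrite (bigD1 0) //= expr0n q1 add0r.
rewrite (eq_bigr (fun=> 1)) => [|y y0]; last first.
  apply: (mulfI y0); rewrite -exprS mulr1 prednK ?expf_card //.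
rewrite sumr_const cardC1 -subn1 natrB //.
by rewrite natr_card_eq0 sub0r.
Qed.

(** In the binomial expansion the exponents of [y] run from [3f] to [6f]; only [4f = q - 1] has a
    nonzero power sum. *)
Lemma sum_jacobi_expr :
  \sum_(y : F) y ^+ (3 * f) * (1 - y) ^+ (3 * f) = - (-1) ^+ f * ('C(3 * f, f))%:R.
Proof.
have fs : (f < (3 * f).+1)%N by lia.
under eq_bigr do rewrite exprBn mulr_sumr.
rewrite exchange_big (bigD1 (Ordinal fs)) //= [X in _ + X]big1 ?addr0.
  under eq_bigr do rewrite expr1n mulr1 mulrnAr mulrCA -exprD.
  rewrite sumrMnl -mulr_sumr (_ : 3 * f + f = q.-1)%N; last by lia.
  by rewrite sum_expr_pred mulrN1 mulr_natr.
move=> i; rewrite -val_eqE /= => nif.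
under eq_bigr do rewrite expr1n mulr1 mulrnAr mulrCA -exprD.
rewrite sumrMnl -mulr_sumr sum_expr ?mulr0 ?mul0rn //.
have := ltn_ord i => hi; apply/negP => /dvdnP [[|[|c]]]; nia.
Qed.
End FieldSums.

(** * Uniqueness of the sum of two squares *)

(** Brahmagupta's identity gives [(a s + 2 b)^2 + (2 a - s b)^2 = q^2], so [2 a - s b = k q] with
    [|k| <= 1]. The left side is even and [q] odd, hence [k = 0] and [2 a = s b]. *)
Lemma two_square_dvd (a b s q : int) : a ^+ 2 + b ^+ 2 = q -> q = s ^+ 2 + 4 ->
  odd `|q|%N -> ~~ odd `|b|%N -> (q %| 2 * a - s * b)%Z -> b ^+ 2 = 4.
Proof.
move=> eab es oq eb /dvdzP [k ek].
have q0 : 0 < q by rewrite es; nia.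
have brahm : (a * s + 2 * b) ^+ 2 + (k * q) ^+ 2 = q ^+ 2.
  rewrite -ek; transitivity ((a ^+ 2 + b ^+ 2) * (s ^+ 2 + 4)); first by ring.
  by rewrite eab -es.
have k2 : k ^+ 2 <= 1.
  have : (k * q) ^+ 2 <= q ^+ 2 by rewrite -brahm lerDr sqr_ge0.
  by rewrite exprMn -{2}[q ^+ 2]mul1r ler_pM2r // exprn_gt0.
have k0 : k = 0.
  have [c ec] : exists c, b = 2 * c by exists (b %/ 2)%Z; lia.
  have : ~~ odd `|(k * q : int)|%N.
    have -> : k * q = 2 * (a - s * c) by rewrite -ek ec; ring.
    by rewrite abszM oddM.
  rewrite abszM oddM oq andbT => ok.
  have : `|k| <= 1 by rewrite -(@expr_le1 _ 2) // real_normK ?num_real.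
  by clear -ok; lia.
have e0 : 2 * a = s * b by lia.
have e1 : q * (b ^+ 2) = q * 4.
  have : (2 * a) ^+ 2 = (s * b) ^+ 2 by rewrite e0.
  by rewrite !exprMn => h; rewrite {1}es mulrDl -h -eab; ring.
by apply: (mulfI (lt0r_neq0 q0)).
Qed.

(** The product of [2 a - s b] and [2 a + s b] is [q (4 - b^2)]. As [p] cannot divide both factors,
    whose sum is [4 a], all of [q] divides one of them; the sign of [b] exchanges the two. *)
Lemma two_square_unique (p n : nat) (a b s : int) : prime p ->
  (p ^ n)%N%:Z = s ^+ 2 + 4 -> a ^+ 2 + b ^+ 2 = (p ^ n)%N%:Z ->
  odd p -> ~~ odd `|b|%N -> ~~ (p%:Z %| a)%Z -> b ^+ 2 = 4.
Proof.
move=> pp es eab op eb pa.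
have oq : odd `|(p ^ n)%N%:Z|%N by rewrite absz_nat oddX op orbT.
have prodE : ((p ^ n)%N%:Z %| (2 * a - s * b) * (2 * a + s * b))%Z.
  apply/dvdzP; exists (4 - b ^+ 2).
  have -> : (2 * a - s * b) * (2 * a + s * b) = 4 * a ^+ 2 - s ^+ 2 * b ^+ 2 by ring.
  have -> : a ^+ 2 = (p ^ n)%N%:Z - b ^+ 2 by rewrite -eab addrK.
  by rewrite es; ring.
have nboth : ~~ ((p%:Z %| 2 * a - s * b)%Z && (p%:Z %| 2 * a + s * b)%Z).
  apply/negP => /andP [d1 d2]; have := rpredD d1 d2.
  have -> : 2 * a - s * b + (2 * a + s * b) = 2 ^+ 2 * a by ring.
  rewrite Gauss_dvdzr ?(negPf pa) //.
  by rewrite coprimezE absz_nat abszX coprimeXr // coprimen2.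
have cop (x : int) : ~~ (p%:Z %| x)%Z -> coprimez (p ^ n)%N x.
  by move=> px; rewrite coprimezE absz_nat coprimeXl // prime_coprime.
move: nboth; rewrite negb_and => /orP [h|h].
  move: prodE; rewrite Gauss_dvdzr ?cop // => h2.
  rewrite -sqrrN; apply: (two_square_dvd (a := a) (s := s) _ es oq); rewrite ?sqrrN //.
    by rewrite abszN.
  by rewrite mulrN opprK.
move: prodE; rewrite Gauss_dvdzl ?cop // => h2.
exact: (two_square_dvd eab es oq eb h2).
Qed.

Lemma expCN1_4 : (-1) ^+ 4 = 1 :> algC. Proof. by rewrite -signr_odd. Qed.

Lemma expC_i4 : 'i ^+ 4 = 1 :> algC.
Proof. by rewrite (exprM _ 2 2) sqrCi sqrrN expr1n. Qed.

Lemma expCN_i4 : (- 'i) ^+ 4 = 1 :> algC.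
Proof. by rewrite (exprM _ 2 2) sqrrN sqrCi sqrrN expr1n. Qed.

Lemma neq1_N1 : (-1 : algC) != 1. Proof. by rewrite eqNr oner_eq0. Qed.

Lemma neq1_i : ('i : algC) != 1.
Proof. by apply: contraNneq neq1_N1 => e; rewrite -sqrCi e expr1n. Qed.

Lemma neq1_Ni : (- 'i : algC) != 1.
Proof. by apply: contraNneq neq1_N1 => e; rewrite -sqrCi -sqrrN e expr1n. Qed.

(** * Parity, norm and reduction modulo [p] of the Jacobi sum *)

Section JacobiSum.
Variables (F : finFieldType) (g : F).
Hypothesis cardF : (#|F| %% 8 = 5)%N.
Hypothesis gen : forall x : F, x != 0 -> exists k : nat, x = g ^+ k.
Local Notation q := #|F|.
Local Notation chi := (chi g).
Local Notation N := (jacobi_count g).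

Definition jacobi_re : int := (N 0)%:Z - (N 2)%:Z.
Definition jacobi_im : int := (N 1)%:Z - (N 3)%:Z.
Local Notation a := jacobi_re.
Local Notation b := jacobi_im.

Lemma jacobi_sumE (K : fieldType) (j : K) : j ^+ 2 = -1 ->
  conv (chi j) (chi j) 1 = a%:~R + b%:~R * j.
Proof.
move=> j2; have j4 : j ^+ 4 = 1 by rewrite (exprM j 2 2) j2 sqrrN expr1n.
have j3 : j ^+ 3 = - j by rewrite exprSr j2 mulN1r.
rewrite jacobi_expand //; under eq_bigr do rewrite -mulr_natr.
rewrite !big_ord_recl big_ord0 /= /bump /= !rmorphB /= !add1n.
by rewrite -!pmulrn j3 j2; ring.
Qed.

(** The counts add up to [q - 2] (take [j = 1]) and have alternating sum -1 (take [j = -1]), so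
    [N 1 + N 3 = (q - 1) / 2], which is even. *)
Lemma jacobi_im_even : ~~ odd `|b|%N.
Proof.
have p1 : (N 0 + N 1 + N 2 + N 3 = q - 2)%N.
  have := jacobi_expand g (expr1n algC 4).
  rewrite !big_ord_recr big_ord0 /= add0r !expr1n -!natrD.
  rewrite /conv; under eq_bigr do rewrite !chi1 -natrM mulnb.
  rewrite -natr_sum => /eqP; rewrite eqr_nat => /eqP <-.
  rewrite -(cardC (pred2 (0 : F) 1)) card2 eq_sym oner_eq0 addKn -sum1_card.
  rewrite [RHS]big_mkcond; apply: eq_bigr => y _ /=.
  by rewrite !inE negb_or subr_eq0 [1 == y]eq_sym; case: andP.
have p2 : (N 0)%:Z - (N 1)%:Z + (N 2)%:Z - (N 3)%:Z = -1.
  apply: (@intr_inj algC).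
  have := jacobi_expand g expCN1_4.
  rewrite (conv_chi_inv cardF gen) ?expCN1_4 ?mulrNN ?mulr1 ?neq1_N1 ?oner_eq0 //.
  rewrite mulr0 sub0r mulrN1 sqrrN expr1n !big_ord_recr big_ord0 /= add0r.
  have N13 : (-1 : algC) ^+ 3 = -1 by rewrite -signr_odd expr1.
  rewrite expr0 expr1 sqrrN expr1n N13 !mulNrn => h.
  by rewrite !rmorphD !rmorphN /= -!pmulrn h.
rewrite /jacobi_im; move: p1 p2 cardF; clear.
move: (N 0) (N 1) (N 2) (N 3) q => n0 n1 n2 n3 r p1 p2 r8.
have e : (n1 + n3 = (r %/ 4) * 2)%N by lia.
have -> : n1%:Z - n3%:Z = 2 * ((r %/ 4)%N%:Z - n3%:Z) by lia.
by rewrite abszM oddM.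
Qed.

(** The product [X X Y Y] is computed twice: as [(X X) (Y Y)] it is [(a^2 + b^2) B^2], and as
    [X (X Y) Y] it is [q B^2]. The diagonal entry [q - 1] of [B^2] is nonzero. *)
Lemma jacobi_norm : a ^+ 2 + b ^+ 2 = q%:Z.
Proof.
apply: (@intr_inj algC); rewrite rmorphD !rmorphXn /= -[(q%:Z)%:~R]pmulrn.
pose h (x : F) : algC := q%:R * (x == 0)%:R + -1.
have N1 := neq1_N1; have i1 := neq1_i; have i4 := expC_i4.
have Ni2 : (- 'i : algC) ^+ 2 = -1 by rewrite sqrrN sqrCi.
pose X := cay (chi ('i : algC)); pose Y := cay (chi (- 'i : algC)).
pose B := cay (chi (-1 : algC)).
have XX : X *m X = (a%:~R + b%:~R * 'i) *: B.
  rewrite cayM; apply/matrixP => i k; rewrite !mxE.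
  by rewrite conv_chi_sqr ?jacobi_sumE ?sqrCi.
have YY : Y *m Y = (a%:~R - b%:~R * 'i) *: B.
  rewrite cayM; apply/matrixP => i k; rewrite !mxE.
  by rewrite conv_chi_sqr ?jacobi_sumE ?Ni2 // mulrN.
have BB : B *m B = cay h.
  rewrite cayM; apply: eq_cay => x.
  by rewrite (conv_chi_inv cardF gen) ?expCN1_4 ?mulrNN ?mulr1 // sqrrN expr1n mul1r.
have XY : X *m Y = - cay h.
  rewrite cayM; apply/matrixP => i k; rewrite !mxE.
  by rewrite conv_chi_inv // ?mulrN -?expr2 sqrCi ?opprK // mulN1r.
have Xh : X *m cay h = q%:R *: X.
  rewrite cayM; apply/matrixP => i k; rewrite !mxE /h conv_delta.
  by rewrite (sum_chi cardF gen) // mulr0 addr0.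
have : X *m X *m (Y *m Y) = q%:R *: cay h.
  by rewrite mulmxA -(mulmxA X X Y) XY mulmxN mulNmx Xh -scalemxAl XY scalerN opprK.
rewrite XX YY -scalemxAl -scalemxAr BB scalerA.
move/matrixP/(_ (enum_rank 0) (enum_rank 0)); rewrite !mxE subrr /h eqxx mulr1.
have q1 : q%:R + -1 != 0 :> algC by rewrite subr_eq0 pnatr_eq1; lia.
move/(mulIf q1) => <-.
by rewrite mulrC -subr_sqr exprMn sqrCi mulrN1 opprK.
Qed.

Lemma jacobi_re_ndvd p : prime p -> p \in [pchar F] -> ~~ (p%:Z %| a)%Z.
Proof.
move=> pp pF; rewrite (dvdz_pcharf pF); apply/negP => /eqP a0.
have b0 : b%:~R = 0 :> F.
  have := congr1 (fun z : int => z%:~R : F) jacobi_norm.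
  rewrite rmorphD !rmorphXn /= a0 -[(q%:Z)%:~R]pmulrn natr_card_eq0 // expr2 mul0r add0r.
  by move/eqP; rewrite expf_eq0 => /eqP.
(* This [j] makes [chi j] the power map of exponent [3f]. Exponent [f] would be useless: the degrees
   stay below [q - 1] and the sum vanishes in [F]. *)
pose j := g ^+ (3 * (q %/ 4)).
have j2 : j ^+ 2 = -1.
  rewrite -exprM -(genN1 cardF gen).
  apply/eqP; rewrite (eq_prim_root_expr (gen_prim cardF gen)).
  rewrite (_ : 3 * (q %/ 4) * 2 = q.-1./2 + q.-1)%N ?modnDr //; lia.
have j4 : j ^+ 4 = 1 by rewrite (exprM j 2 2) j2 sqrrN expr1n.
have chiE y : chi j y = y ^+ (3 * (q %/ 4)).
  have [->|y0] := eqVneq y 0.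
    have f0 : (0 < 3 * (q %/ 4))%N by lia.
    by rewrite chi0 expr0n gtn_eqF.
  have [k ->] := gen y0; rewrite (chi_gen cardF gen) //.
  by rewrite -!exprM mulnC.
have := jacobi_sumE j2; rewrite a0 b0 mul0r addr0 /conv.
under eq_bigr do rewrite !chiE.
rewrite (sum_jacobi_expr cardF gen) => /eqP.
have q4 : q = (4 * (q %/ 4)).+1 by lia.
rewrite mulf_eq0 oppr_eq0 signr_eq0 /= -(dvdn_pcharf pF).
have e : q = (p ^ logn p q)%N := card_pprimeChar pF.
apply/negP; apply: (@prime_ndvd_bin3 p (logn p q)); rewrite -?e //.
Qed.

Lemma jacobi_im_sqr (s : int) : q%:Z = s ^+ 2 + 4 -> b ^+ 2 = 4.
Proof.
have [p pp pF] := finPcharP F.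
have e : q = (p ^ logn p q)%N := card_pprimeChar pF.
move=> qs; apply: (@two_square_unique p (logn p q) a b s pp).
- by rewrite -e.
- by rewrite -e jacobi_norm.
- have : odd q by clear -cardF; lia.
  by rewrite e oddX => /orP [/eqP l0|//]; move: cardF; rewrite e l0.
- exact: jacobi_im_even.
- exact: jacobi_re_ndvd.
Qed.
End JacobiSum.

(** * The characteristic polynomial *)

(** Of the factors [p - r], [p + r], [p^2 + r^2] of [p^4 - r^4], the last two have leading
    coefficient 2. *)
Lemma monic_exp4_inj (R : numDomainType) (p r : {poly R}) :
  p \is monic -> r \is monic -> p ^+ 4 = r ^+ 4 -> p = r.
Proof.
move=> /monicP mp /monicP mr e.
have : (p - r) * ((p + r) * (p ^+ 2 + r ^+ 2)) == 0.
  have -> : (p - r) * ((p + r) * (p ^+ 2 + r ^+ 2)) = p ^+ 4 - r ^+ 4 by ring.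
  by rewrite e subrr.
rewrite mulf_eq0 subr_eq0 => /orP [/eqP //|].
rewrite mulf_eq0 !addr_eq0 => /orP [] /eqP /(congr1 lead_coef).
  by rewrite lead_coefN mp mr => /eqP; rewrite -addr_eq0 -mulr2n pnatr_eq0.
by rewrite lead_coefN !expr2 !lead_coefM mp mr mulr1 => /eqP;
  rewrite -addr_eq0 -mulr2n pnatr_eq0.
Qed.

(** * The tournament in terms of quartic characters *)

Section Tournament.
Variables (F : finFieldType) (g : F).
Hypothesis cardF : (#|F| %% 8 = 5)%N.
Hypothesis gen : forall x : F, x != 0 -> exists k : nat, x = g ^+ k.
Local Notation q := #|F|.

Lemma mem_cyc4 k : (g ^+ k \in cyc4 F) = (k %% 4 == 0)%N.
Proof.
have g0 := gen_neq0 cardF gen.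
rewrite inE; apply/existsP/eqP => [[y /andP [y0 /eqP e]]|k4].
  have [m em] := gen y0; move: e; rewrite em -exprM => /(eq_gen_exp4 cardF gen) ->.
  by rewrite modnMl.
exists (g ^+ (k %/ 4)); rewrite expf_neq0 //= -exprM; apply/eqP; congr (_ ^+ _).
by lia.
Qed.

Lemma ct_conn0 : (0 \in ct_conn g) = false.
Proof.
apply/negP; rewrite inE inE => /orP [|/imsetP [x]].
  by case/existsP => y /andP [y0]; rewrite eq_sym expf_eq0 /= (negPf y0).
rewrite inE => /existsP [y /andP [y0 /eqP ->]] /esym /eqP.
by rewrite mulf_eq0 expf_eq0 /= (negPf y0) (negPf (gen_neq0 cardF gen)).
Qed.

Lemma mem_ct_conn k : (g ^+ k \in ct_conn g) = (k %% 4 < 2)%N.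
Proof.
have g0 := gen_neq0 cardF gen.
(* Membership in [g C_0] is tested by [k + 3] instead of [k - 1], which would truncate at 0;
   multiplying by [g^4] preserves [C_0]. *)
have -> : (g ^+ k \in ct_conn g) = (k %% 4 == 0)%N || (k.+3 %% 4 == 0)%N.
  rewrite inE mem_cyc4; congr (_ || _); rewrite -mem_cyc4.
  have e3 : g ^+ k.+3 = g ^+ k * g ^+ 3 by rewrite -exprD addn3.
  have p4 x : x \in cyc4 F -> g ^+ 4 * x \in cyc4 F /\ x / g ^+ 4 \in cyc4 F.
    rewrite !inE => /existsP [y /andP [y0 /eqP ->]]; split; apply/existsP.
      by exists (g * y); rewrite mulf_neq0 //= exprMn.
    by exists (y / g); rewrite mulf_neq0 ?invr_eq0 //= exprMn exprVn.
  apply/imsetP/idP => [[x xc e]|h].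
    by rewrite e3 e [g * x]mulrC -mulrA -exprS mulrC; case: (p4 _ xc).
  exists (g ^+ k.+3 / g ^+ 4); first by case: (p4 _ h).
  rewrite e3 -mulrA [g ^+ 4]exprSr invfM; field.
  by rewrite g0.
by lia.
Qed.

(** The coefficients make the values at [g^0], [g^1], [g^2], [g^3] equal to 1, 1, -1, -1: the sign
    is 1 on the connection set and -1 on the other nonzero elements. *)
Definition ct_sign (x : F) : algC :=
  (1 - 'i) / 2 * chi g 'i x + (1 + 'i) / 2 * chi g (- 'i) x.

Lemma ct_sign_conn (x : F) :
  ((x \in ct_conn g) : nat)%:R * 2 = 1 - (x == 0)%:R + ct_sign x.
Proof.
rewrite /ct_sign; have [->|x0] := eqVneq x 0.
  rewrite ct_conn0 !chi0 ?eqxx /=; ring.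
have [k ->] := gen x0; rewrite mem_ct_conn !(chi_gen cardF gen) ?expC_i4 ?expCN_i4 //.
rewrite -(expr_mod k expC_i4) -(expr_mod k expCN_i4).
have i2 : 'i * 'i = -1 :> algC by rewrite -expr2 sqrCi.
have : (k %% 4 < 4)%N by rewrite ltn_pmod.
by case: (k %% 4)%N => [|[|[|[|//]]]] _ /=; rewrite ?expr0 ?expr1; field: i2.
Qed.

Lemma sum_ct_sign : \sum_x ct_sign x = 0.
Proof.
rewrite big_split /= -!mulr_sumr !(sum_chi cardF gen) ?mulr0 ?addr0 //.
- exact: expCN_i4.
- exact: neq1_Ni.
- exact: expC_i4.
- exact: neq1_i.
Qed.

Lemma ct_signN x : ct_sign (- x) = - ct_sign x.
Proof.
rewrite /ct_sign -[- x]mulN1r.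
have [_ _ ->] := chi_mulchar cardF gen expC_i4.
have [_ _ ->] := chi_mulchar cardF gen expCN_i4.
rewrite !(chiN1 cardF gen) ?expC_i4 ?expCN_i4 // sqrrN sqrCi; ring.
Qed.

(** The squared coefficients are [-i/2] and [i/2], so [a] cancels and [b] remains; the two mixed
    terms have coefficient [1/2] each. *)
Lemma conv_ct_sign x : conv ct_sign ct_sign x =
  (jacobi_im g)%:~R * chi g (-1) x - (q%:R * (x == 0)%:R - 1).
Proof.
have i2 : 'i ^+ 2 = -1 :> algC := sqrCi _.
have Ni2 : (- 'i) ^+ 2 = -1 :> algC by rewrite sqrrN.
have ii : conv (chi g 'i) (chi g 'i) x =
    ((jacobi_re g)%:~R + (jacobi_im g)%:~R * 'i) * chi g (-1 : algC) x.
  by rewrite (conv_chi_sqr cardF gen) ?jacobi_sumE // i2 neq1_N1.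
have NN : conv (chi g (- 'i)) (chi g (- 'i)) x =
    ((jacobi_re g)%:~R - (jacobi_im g)%:~R * 'i) * chi g (-1 : algC) x.
  by rewrite (conv_chi_sqr cardF gen) ?jacobi_sumE ?mulrN // Ni2 neq1_N1.
have iN : conv (chi g ('i : algC)) (chi g (- 'i)) x = 1 - q%:R * (x == 0)%:R.
  rewrite (conv_chi_inv cardF gen) ?expC_i4 ?neq1_i ?mulrN -?expr2 ?i2 ?opprK //.
  by ring.
have Ni : conv (chi g (- 'i : algC)) (chi g 'i) x = 1 - q%:R * (x == 0)%:R.
  rewrite (conv_chi_inv cardF gen) ?expCN_i4 ?neq1_Ni ?mulNr -?expr2 ?i2 ?opprK //.
  by rewrite Ni2; ring.
rewrite /ct_sign conv_comb ii NN iN Ni.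
by field: i2.
Qed.

Lemma char_poly_ct_exp4 (s : int) : q%:Z = s ^+ 2 + 4 ->
  let Y : {poly algC} := 2 * 'X + 1 in
  (2 ^+ q * char_poly (ct_adj g)) ^+ 4 =
  (Y - q%:R) ^+ 4 * ((Y ^+ 2 + q%:R) ^+ 2 - 4 * q%:R) ^+ q.-1.
Proof.
move=> qs Y.
pose f x := (ct_sign x)%:P; pose psi x := (chi g (-1 : algC) x)%:P.
have b2 := jacobi_im_sqr cardF gen qs.
rewrite -(@det_tournament _ _ f psi (jacobi_im g)%:~R Y g).
(* The factor [2^q] doubles each row, and [2 (X I - A) = Y I - M - J]. *)
- congr (_ ^+ 4); rewrite -detZ; congr (\det _); apply/matrixP => i k; rewrite !mxE.
  have := congr1 polyC (ct_sign_conn (enum_val i - enum_val k)).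
  rewrite subr_eq0 (inj_eq enum_val_inj) /f /Y; move: (ct_sign _) => t.
  rewrite !(rmorphB, rmorphD, rmorphM, rmorph1, rmorph_nat) /= => h.
  rewrite mulrBr [X in _ - X]mulrC h.
  by case: (i == k); ring.
- by rewrite /f -rmorph_sum sum_ct_sign.
- by move=> x; rewrite /f ct_signN polyCN.
- move=> x; rewrite (conv_rmorph polyC ct_sign ct_sign) conv_ct_sign.
  by rewrite !(rmorphB, rmorphM, rmorph1, rmorph_nat, rmorph_int).
- by rewrite /psi -rmorph_sum (sum_chi cardF gen) ?expCN1_4 ?neq1_N1.
- move=> x; rewrite (conv_rmorph polyC (chi g (-1)) (chi g (-1))).
  rewrite (conv_chi_inv cardF gen) ?expCN1_4 ?mulrNN ?mulr1 ?neq1_N1 //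
    sqrrN expr1n mul1r.
  by rewrite !(rmorphB, rmorphM, rmorph1, rmorph_nat, rmorph_int).
- exact: (gen_neq0 cardF gen).
- move=> x; rewrite /psi; have [_ _ ->] := chi_mulchar cardF gen expCN1_4.
  have := chi_gen cardF gen 1 expCN1_4; rewrite !expr1 => ->.
  by rewrite mulN1r polyCN.
- by rewrite -rmorphXn /= b2.
(* At [X = 0], where [Y = 1], the polynomial takes the value [(q - 1)^2]. *)
apply/eqP => /(congr1 (fun p : {poly algC} => p.[0])).
rewrite -[q%:R]polyC_natr -[4]polyC_natr /Y !hornerE => h.
have : (q%:R - 1 : algC) ^+ 2 == 0 by apply/eqP; rewrite -[RHS]h; ring.
by rewrite expf_eq0 subr_eq0 pnatr_eq1; move: cardF; case: eqP => // ->.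
Qed.
End Tournament.

Theorem theorem2 (F : finFieldType) (g : F) (s : int) :
  (#|F| %% 8 = 5)%N ->
  odd `|s|%N ->
  (#|F|%:Z = s ^+ 2 + 4)%R ->
  (forall x : F, x != 0 -> exists k : nat, x = g ^+ k) ->
  let q : algC := (#|F|)%:R in
  let m : nat := ((#|F| - 1) %/ 4)%N in
  char_poly (ct_adj g) =
    ('X - ((q - 1) / 2)%:P)
    * ('X - ((-1 + 'i * sqrtC (q - 2 * sqrtC q)) / 2)%:P) ^+ m
    * ('X - ((-1 - 'i * sqrtC (q - 2 * sqrtC q)) / 2)%:P) ^+ m
    * ('X - ((-1 + 'i * sqrtC (q + 2 * sqrtC q)) / 2)%:P) ^+ m
    * ('X - ((-1 - 'i * sqrtC (q + 2 * sqrtC q)) / 2)%:P) ^+ m.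
Proof.
move=> cardF _ qs gen q m.
apply: monic_exp4_inj; first exact: char_poly_monic.
  by rewrite !(monicMl, monicXsubC, monic_exp) // !monicMl ?monic_exp ?monicXsubC.
have card4 : #|F| = (4 * m).+1 by rewrite /m; lia.
have := char_poly_ct_exp4 cardF gen qs.
set Y : {poly algC} := 2 * 'X + 1 => /= e.
(* In the variable [Y] the eigenvalue [(-1 + z) / 2] becomes the root [z]. *)
have two z : 2 * ('X - ((-1 + z) / 2)%:P) = Y - z%:P.
  have -> : z = 2 * ((-1 + z) / 2) + 1 by field.
  rewrite [in RHS]rmorphD [in RHS]rmorphM rmorph1 rmorph_nat /Y.
  have -> : (-1 + (2 * ((-1 + z) / 2) + 1)) / 2 = (-1 + z) / 2 by field.
  by ring.
have nz : (2 ^+ #|F| : {poly algC}) ^+ 4 != 0.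
  by rewrite !expf_neq0 // -polyC_natr polyC_eq0 pnatr_eq0.
apply: (mulfI nz); rewrite -!exprMn {}e.
have root2 (w : algC) :
    (Y - ('i * sqrtC w)%:P) * (Y - (- ('i * sqrtC w))%:P) = Y ^+ 2 + w%:P.
  rewrite polyCN opprK -subr_sqr -rmorphXn /= exprMn sqrCi sqrtCK mulN1r.
  by rewrite polyCN opprK.
have quartic : (Y ^+ 2 + #|F|%:R) ^+ 2 - 4 * #|F|%:R =
    (Y ^+ 2 + (q - 2 * sqrtC q)%:P) * (Y ^+ 2 + (q + 2 * sqrtC q)%:P).
  have sqrt_q : (sqrtC q)%:P ^+ 2 = #|F|%:R :> {poly algC}.
    by rewrite -rmorphXn /= sqrtCK polyC_natr.
  rewrite polyCB polyCD polyCM !polyC_natr -sqrt_q; ring.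
have lin : Y - #|F|%:R = 2 * ('X - ((q - 1) / 2)%:P).
  by rewrite [q - 1]addrC two polyC_natr.
(* The power [2^q] is shared out, one 2 to each of the [4m + 1] linear factors. *)
rewrite quartic lin -!root2 -!two card4 /= mulnC [2 ^+ _]exprS !exprM !exprMn.
by ring.
Qed.
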